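(* Let $q$ be a prime power, let $m_1,m_2\ge1$, $s_1,s_2\ge1$ and $u_1,u_2\ge0$ be integers, and let $\mathbf{e}=(e_1,\dots,e_{s_1})\in\mathbb{N}^{s_1}$, $\mathbf{f}=(f_1,\dots,f_{s_2})\in\mathbb{N}^{s_2}$. If a digital $(u_1,m_1,\mathbf{e},s_1)$-net over $\mathbb{F}_q$ and a digital $(u_2,m_2,\mathbf{f},s_2)$-net over $\mathbb{F}_q$ are given, then one can construct a digital $(u,m_1+m_2,(\mathbf{e},\mathbf{f}),s_1+s_2)$-net over $\mathbb{F}_q$ with $u=\max\{m_1+u_2,m_2+u_1\}$ and $(\mathbf{e},\mathbf{f})=(e_1,\dots,e_{s_1},f_1,\dots,f_{s_2})\in\mathbb{N}^{s_1+s_2}$.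
   Context: $\mathbb{N}$ denotes the positive integers, $\lambda_s$ Lebesgue measure. An elementary interval in base $b$ is $J=\prod_{i=1}^s[a_ib^{-d_i},(a_i+1)b^{-d_i})$ with integers $d_i\ge0$, $0\le a_i<b^{d_i}$. For integers $0\le u\le m$ and $\mathbf{e}=(e_1,\dots,e_s)\in\mathbb{N}^s$, a set of $b^m$ points in $[0,1)^s$ is a $(u,m,\mathbf{e},s)$-net in base $b$ if every elementary interval $J$ in base $b$ with $\lambda_s(J)\ge b^{u-m}$ and $e_i\mid d_i$ for all $i$ contains exactly $b^m\lambda_s(J)$ of the points. Digital net over $\mathbb{F}_q$: given $m\times m$ generating matrices $C_1,\dots,C_s$ over $\mathbb{F}_q$, bijections $\eta_r:Z_q\to\mathbb{F}_q$ ($0\le r<m$) and $\kappa_{i,j}:\mathbb{F}_q\to Z_q$ where $Z_q=\{0,\dots,q-1\}$, for $0\le n<q^m$ with base-$q$ digits $n_0,\dots,n_{m-1}$ put $(y^{(i)}_{n,1},\dots,y^{(i)}_{n,m})^\top=C_i(\eta_0(n_0),\dots,\eta_{m-1}(n_{m-1}))^\top$, $x_n^{(i)}=\sum_{j=1}^m\kappa_{i,j}(y^{(i)}_{n,j})q^{-j}$, $\mathbf{x}_n=(x_n^{(1)},\dots,x_n^{(s)})$. The resulting point set is a digital net over $\mathbb{F}_q$; it is a digital $(u,m,\mathbf{e},s)$-net over $\mathbb{F}_q$ if it is a $(u,m,\mathbf{e},s)$-net in base $q$. *)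

(* Defs.v *)
From mathcomp Require Import all_boot all_order all_algebra.
From mathcomp Require Import all_classical all_reals all_analysis.
From mathcomp Require Import measurable_realfun.

Set Implicit Arguments.
Unset Strict Implicit.
Unset Printing Implicit Defensive.

Import Order.TTheory GRing.Theory Num.Theory.
Import numFieldNormedType.Exports.

Local Open Scope classical_set_scope.
Local Open Scope ring_scope.

(* The [s]-fold product of the one-dimensional Lebesgue measure, as an iterated
   integral over sections (this is [product_measure1] iterated; on 0-tuples it
   is the unit mass at the empty tuple). It is only meaningful on measurable
   sets. *)
Fixpoint lebesgue_tuple (R : realType) (s : nat) : set (s.-tuple R) -> \bar R :=
  match s with
  | 0 => fun A => dirac [tuple] A
  | s'.+1 => fun A =>
      (\int[@lebesgue_measure R]_(x in [set: R])
         lebesgue_tuple [set t : s'.-tuple R | A (cons_tuple (x : R) t)])%E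
  end.

Lemma lebesgue_tuple_box (R : realType) s (I : 'I_s -> interval R) :
  lebesgue_tuple [set x : s.-tuple R | forall i, tnth x i \in I i] =
  (\prod_(i < s) lebesgue_measure [set` I i])%E.
Proof.
elim: s I => [|s IH] I.
  rewrite big_ord0 /= diracE mem_set //=. by case.
rewrite big_ord_recl /=.
under eq_integral => x _.
  have -> : lebesgue_tuple [set t : s.-tuple R | (forall i, tnth (cons_tuple (x:R) t) i \in I i)] =
   ((\prod_(i < s) lebesgue_measure [set` I (lift ord0 i)]) * (\1_[set` I ord0] x)%:E)%E.
    rewrite -IH indicE.
    case: (boolP (x \in [set` I ord0])) => hx.
      rewrite mule1; congr lebesgue_tuple; apply/seteqP; split=> t /=.
        by move=> h i; have := h (lift ord0 i); rewrite tnthS.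
      move=> h i; case: (unliftP ord0 i) => [j ->|->]; first by rewrite tnthS.
      by rewrite tnth0; move: hx; rewrite inE.
    rewrite mule0 (_ : [set t | _] = set0); last first.
      apply/seteqP; split=> t //= h; move: hx; rewrite notin_setE /=; apply.
      by have := h ord0; rewrite tnth0.
    have H0 k : lebesgue_tuple (set0 : set (k.-tuple R)) = 0%E.
      elim: k => [|k IHk] /=; first by rewrite dirac0.
      under eq_integral => y _ do rewrite (_ : [set t | _] = set0) // IHk.
      by rewrite integral0.
    by rewrite H0.
  over.
rewrite ge0_integralZl //=.
- by rewrite integral_indic // setIT muleC.
- apply/measurable_EFinP; exact: measurable_indic.
- by apply: prode_ge0 => i _; exact: measure_ge0.
Qed.

Definition elementary_interval (R : realType) (b s : nat) (d a : s.-tuple nat) :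
    set (s.-tuple R) :=
  [set x | forall i, (tnth a i)%:R / b%:R ^+ tnth d i <= tnth x i
                     < (tnth a i).+1%:R / b%:R ^+ tnth d i].

(* Points are indexed by ['I_(b ^ m)] and counted with multiplicity. *)
Definition is_net (R : realType) (b u m s : nat) (e : s.-tuple nat)
    (P : 'I_(b ^ m) -> s.-tuple R) : Prop :=
  [/\ (u <= m)%N,
      forall n i, 0 <= tnth (P n) i < 1 &
      forall d a : s.-tuple nat,
        (forall i, (tnth a i < b ^ tnth d i)%N) ->
        let J : set (s.-tuple R) := elementary_interval b d a in
        ((b%:R ^ (u%:Z - m%:Z))%:E <= lebesgue_tuple J)%E ->
        (forall i, (tnth e i %| tnth d i)%N) ->
        (#|[pred n | P n \in J]|%:R%:E = (b%:R ^+ m)%:E * lebesgue_tuple J)%E].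

Lemma card_finField_gt0 (F : finFieldType) : (0 < #|F|)%N.
Proof. exact: ltnW (card_finNzRing_gt1 F). Qed.

Section DigitalNet.
Variables (R : realType) (F : finFieldType).
Local Notation q := #|F|.

Definition digit (n r : nat) : 'I_q :=
  Ordinal (ltn_pmod (n %/ q ^ r) (card_finField_gt0 F)).

(* The digits [y_1, ..., y_m] are indexed from 0, hence the exponent [j.+1]. *)
Definition digital_point (m s : nat) (C : 'I_s -> 'M[F]_m)
    (eta : 'I_m -> 'I_q -> F) (kappa : 'I_s -> 'I_m -> F -> 'I_q) (n : nat) :
    s.-tuple R :=
  [tuple \sum_(j < m)
     (kappa i j ((C i *m \col_r eta r (digit n r)) j 0))%:R / q%:R ^+ j.+1
   | i < s].

Definition is_digital (m s : nat) (P : 'I_(q ^ m) -> s.-tuple R) : Prop :=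
  exists (C : 'I_s -> 'M[F]_m) (eta : 'I_m -> 'I_q -> F)
         (kappa : 'I_s -> 'I_m -> F -> 'I_q),
    [/\ forall r, bijective (eta r),
        forall i j, bijective (kappa i j) &
        forall n, P n = digital_point C eta kappa n].

Definition is_digital_net (u m s : nat) (e : s.-tuple nat)
    (P : 'I_(q ^ m) -> s.-tuple R) : Prop :=
  is_digital P /\ is_net (b := q) u e P.

End DigitalNet.

(* Main.v *)
(** The direct product of the two nets: the point of index [n] is the point of
    index [n mod q^m1] of the first net followed by the point of index
    [n div q^m1] of the second one. An elementary interval splits as
    [J = J1 * J2]; as both factors have measure at most 1 and
    [u - (m1 + m2) = max (u1 - m1) (u2 - m2)], the lower bound on the measure of
    [J] gives those required for [J1] and [J2], and the numbers of points
    multiply. The product is digital: each generating matrix acts on its own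
    block of digits of [n] and is padded with zero rows, and the bijections for
    the new rows send 0 to 0, so that the coordinates are unchanged. *)

Require Import Defs.
From mathcomp Require Import all_boot all_order all_algebra.
From mathcomp Require Import all_classical all_reals all_analysis.
From mathcomp Require Import perm.

Set Implicit Arguments.
Unset Strict Implicit.
Unset Printing Implicit Defensive.

Import Order.TTheory GRing.Theory Num.Theory.

Local Open Scope classical_set_scope.
Local Open Scope ring_scope.

Section SplitIndex.
Variables b k l : nat.
Implicit Type n : 'I_(b ^ (k + l)).

(** An index [n] witnesses that [b ^ (k + l)] is positive, hence so is its factor [b ^ k]. *)
Let expn_gt0_index n : (0 < b ^ k)%N.
Proof.
have := leq_ltn_trans (leq0n n) (ltn_ord n).
by rewrite expnD muln_gt0 => /andP[].
Qed.

Lemma ltn_low_digits n : (n %% b ^ k < b ^ k)%N.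
Proof. by rewrite ltn_mod; exact: expn_gt0_index n. Qed.

Lemma ltn_high_digits n : (n %/ b ^ k < b ^ l)%N.
Proof.
by rewrite ltn_divLR ?(expn_gt0_index n) // mulnC -expnD ltn_ord.
Qed.

Definition low_digits n : 'I_(b ^ k) := Ordinal (ltn_low_digits n).
Definition high_digits n : 'I_(b ^ l) := Ordinal (ltn_high_digits n).

Lemma split_digits_bij : bijective (fun n => (low_digits n, high_digits n)).
Proof.
(* Instead of an explicit inverse: Euclidean division gives injectivity, and both types have the
   same cardinality. *)
apply: inj_card_bij => [n n' [lo hi]|].
  by apply: val_inj; rewrite /= (divn_eq n (b ^ k)) (divn_eq n' (b ^ k)) lo hi.
by rewrite card_prod !card_ord expnD.
Qed.

Lemma card_split_digits (A : pred 'I_(b ^ k)) (B : pred 'I_(b ^ l)) :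
  #|[pred n | A (low_digits n) && B (high_digits n)]| = (#|A| * #|B|)%N.
Proof.
rewrite -cardX -(on_card_preimset (onW_bij _ split_digits_bij)).
by apply: eq_card => n; rewrite !inE.
Qed.

End SplitIndex.

Section ElementaryInterval.
Variables (R : realType) (b : nat).

(** The volume of an elementary interval as a real number; it depends on [d] only, not on the
    position [a]. *)
Definition side_product s (d : s.-tuple nat) : R :=
  \prod_(i < s) (b%:R ^+ tnth d i)^-1.

Lemma lebesgue_elementary_interval s (d a : s.-tuple nat) : (0 < b)%N ->
  lebesgue_tuple (elementary_interval (R := R) b d a) = (side_product d)%:E.
Proof.
move=> b_gt0.
have -> : elementary_interval (R := R) b d a =
    [set x | forall i, tnth x i \in
       `[(tnth a i)%:R / b%:R ^+ tnth d i,
         (tnth a i).+1%:R / b%:R ^+ tnth d i[ ].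
  by apply/seteqP; split=> x /= xP i; have := xP i; rewrite in_itv.
rewrite lebesgue_tuple_box -prodEFin; apply: eq_bigr => i _.
have bX_gt0 : 0 < b%:R ^+ tnth d i :> R by rewrite exprn_gt0 ?ltr0n.
(* The length formula tests whether the endpoints are in order; consecutive numerators over a
   positive denominator are. *)
rewrite lebesgue_measure_itv /= lte_fin ltr_pM2r ?invr_gt0 // ltr_nat ltnSn.
by rewrite -EFinB -mulrBl -natrB // subSnn mul1r.
Qed.

Lemma side_product_ge0 s (d : s.-tuple nat) : 0 <= side_product d.
Proof. by apply: prodr_ge0 => i _; rewrite invr_ge0 exprn_ge0. Qed.

Lemma side_product_le1 s (d : s.-tuple nat) : (0 < b)%N -> side_product d <= 1.
Proof.
move=> b_gt0; apply: prodr_ile1 => i _.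
have bX_ge1 : 1 <= b%:R ^+ tnth d i :> R by rewrite exprn_ege1 ?ler1n.
by rewrite invr_ge0 (le_trans ler01) //= invf_le1 // (lt_le_trans ltr01).
Qed.

Definition ltuple T k l (t : (k + l).-tuple T) : k.-tuple T :=
  [tuple tnth t (lshift l i) | i < k].
Definition rtuple T k l (t : (k + l).-tuple T) : l.-tuple T :=
  [tuple tnth t (rshift k i) | i < l].

Lemma side_productD k l (d : (k + l).-tuple nat) :
  side_product d = side_product (ltuple d) * side_product (rtuple d).
Proof.
rewrite /side_product big_split_ord /=.
by congr (_ * _); apply: eq_bigr => i _; rewrite tnth_mktuple.
Qed.

Lemma mem_elementary_interval_cat k l (d a : (k + l).-tuple nat)
    (x : k.-tuple R) (y : l.-tuple R) :
  (cat_tuple x y \in elementary_interval b d a) =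
  (x \in elementary_interval b (ltuple d) (ltuple a)) &&
  (y \in elementary_interval b (rtuple d) (rtuple a)).
Proof.
apply/idP/andP => [/set_mem xyP|[/set_mem xP /set_mem yP]].
  split; apply/mem_set => i; rewrite !tnth_mktuple.
    by have := xyP (lshift l i); rewrite tnth_lshift.
  by have := xyP (rshift k i); rewrite tnth_rshift.
apply/mem_set => i; case: (split_ordP i) => j ->.
  by have := xP j; rewrite !tnth_mktuple tnth_lshift.
by have := yP j; rewrite !tnth_mktuple tnth_rshift.
Qed.

End ElementaryInterval.

Section ProductNet.
Variables (R : realType) (b m1 m2 s1 s2 : nat).
Variables (P1 : 'I_(b ^ m1) -> s1.-tuple R) (P2 : 'I_(b ^ m2) -> s2.-tuple R).

Definition product_points (n : 'I_(b ^ (m1 + m2))) : (s1 + s2).-tuple R :=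
  cat_tuple (P1 (low_digits n)) (P2 (high_digits n)).

Lemma is_net_product u1 u2 (e : s1.-tuple nat) (f : s2.-tuple nat) :
  (0 < b)%N -> is_net u1 e P1 -> is_net u2 f P2 ->
  is_net (maxn (m1 + u2) (m2 + u1)) (cat_tuple e f) product_points.
Proof.
move=> b_gt0 [u1m1 P1_01 net1] [u2m2 P2_01 net2]; split.
- by rewrite geq_max leq_add2l u2m2 addnC leq_add2r.
- move=> n i; case: (split_ordP i) => j ->; first by rewrite tnth_lshift.
  by rewrite tnth_rshift.
move=> d a a_lt /=; rewrite lebesgue_elementary_interval // side_productD lee_fin.
set u := maxn _ _ => Jge ef_dvd.
have b_ge1 : 1 <= b%:R :> R by rewrite ler1n.
(* Comparison of the volume thresholds, with the exponent inequality [v - k <= u - (m1 + m2)]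
   written without subtraction; used at [(u2, m2)] and [(u1, m1)]. *)
have expo_le v k : (v + (m1 + m2) <= u + k)%N ->
    b%:R ^ (v%:Z - k%:Z) <= b%:R ^ (u%:Z - (m1 + m2)%N%:Z) :> R.
  by move=> vu; apply: ler_weXz2l => //; rewrite lerBlDr addrAC lerBrDr lez_nat.
rewrite (eq_card (B := [pred n |
    (P1 (low_digits n) \in elementary_interval b (ltuple d) (ltuple a)) &&
    (P2 (high_digits n) \in elementary_interval b (rtuple d) (rtuple a))]));
  last by move=> n; rewrite !inE mem_elementary_interval_cat.
rewrite (card_split_digits
  (fun n => P1 n \in elementary_interval b (ltuple d) (ltuple a))
  (fun n => P2 n \in elementary_interval b (rtuple d) (rtuple a))).
(* After the main equation, the side conditions come for the second factor, then for the first. *)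
rewrite natrM EFinM /= (net1 _ (ltuple a)) ?(net2 _ (rtuple a)).
- by rewrite !lebesgue_elementary_interval // -!EFinM exprD mulrACA.
- by move=> i; rewrite !tnth_mktuple; exact: a_lt.
- rewrite lebesgue_elementary_interval // lee_fin.
  apply: (le_trans (expo_le u2 m2 _)).
    by rewrite addnCA addnA leq_add2r leq_maxl.
  (* Dropping the volume of the other factor, at most 1, can only enlarge the product. *)
  apply: (le_trans Jge); apply: ler_piMl; first exact: side_product_ge0.
  exact: side_product_le1.
- by move=> i; have := ef_dvd (rshift s1 i); rewrite tnth_rshift tnth_mktuple.
- by move=> i; rewrite !tnth_mktuple; exact: a_lt.
- rewrite lebesgue_elementary_interval // lee_fin.
  apply: (le_trans (expo_le u1 m1 _)).
    by rewrite addnA addnAC leq_add2r addnC leq_maxr.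
  apply: (le_trans Jge); apply: ler_piMr; first exact: side_product_ge0.
  exact: side_product_le1.
- by move=> i; have := ef_dvd (lshift s2 i); rewrite tnth_lshift tnth_mktuple.
Qed.

End ProductNet.

Section ProductDigital.
Variables (R : realType) (F : finFieldType).
Local Notation q := #|F|.

(** Dividing [n %% q ^ k] by [q ^ r] gives [n %/ q ^ r] modulo [q ^ (k - r)], and [q] divides this
    modulus because [r < k]. *)
Lemma low_digits_digit k l (n : 'I_(q ^ (k + l))) (r : 'I_k) :
  digit F (low_digits n) r = digit F n r.
Proof.
apply: val_inj; rewrite /= divn_modl; last exact: dvdn_exp2l (ltnW _).
rewrite -(expnB (card_finField_gt0 F) (ltnW (ltn_ord r))) modn_dvdm //.
by rewrite dvdn_exp // subn_gt0.
Qed.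

Lemma high_digits_digit k l (n : 'I_(q ^ (k + l))) r :
  digit F (high_digits n) r = digit F n (k + r)%N.
Proof. by apply: val_inj; rewrite /= -divnMA -expnD. Qed.

Definition zero_index : 'I_q := Ordinal (card_finField_gt0 F).

(** The rank of 0 in the enumeration of [F] need not be 0; the transposition corrects this and keeps
    the map bijective. *)
Definition kappa0 (x : F) : 'I_q :=
  tperm (enum_rank 0) zero_index (enum_rank x).

Lemma kappa0_bij : bijective kappa0.
Proof.
by apply: bij_comp (enum_rank_bij _); exact: injF_bij perm_inj.
Qed.

Lemma kappa0_0 : kappa0 0 = 0%N :> nat.
Proof. by rewrite /kappa0 tpermL. Qed.

Section Padding.
Variables (k l m : nat) (klm : (k + l = m)%N).

(** The row count is cast along [klm] so that [m2 + m1] rows can serve where [m1 + m2] are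
    expected. *)
Definition pad_matrix c (A : 'M[F]_(k, c)) : 'M[F]_(m, c) :=
  castmx (klm, erefl c) (col_mx A (0 : 'M[F]_(l, c))).

Definition pad_kappa (kappa : 'I_k -> F -> 'I_q) (j : 'I_m) : F -> 'I_q :=
  if fintype.split (cast_ord (esym klm) j) is inl j' then kappa j' else kappa0.

Lemma pad_kappa_bij kappa j :
  (forall j', bijective (kappa j')) -> bijective (pad_kappa kappa j).
Proof.
rewrite /pad_kappa => kappa_bij.
by case: fintype.split => // _; exact: kappa0_bij.
Qed.

End Padding.

(** The rows of [A] come first and so keep their weights; each zero row yields the digit [kappa0 0],
    which is 0. *)
Lemma sum_pad k l m (klm : (k + l = m)%N) c (A : 'M[F]_(k, c)) (v : 'cV[F]_c)
    (kappa : 'I_k -> F -> 'I_q) :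
  \sum_(j < m) (pad_kappa klm kappa j ((pad_matrix klm A *m v) j 0))%:R
                 / q%:R ^+ j.+1 =
  \sum_(j < k) (kappa j ((A *m v) j 0))%:R / q%:R ^+ j.+1 :> R.
Proof.
(* Replacing [m] by [k + l] makes the casts trivial. *)
case: m / klm; rewrite big_split_ord /= [X in _ + X]big1 => [|j _].
  rewrite addr0; apply: eq_bigr => j _.
  rewrite /pad_kappa /pad_matrix castmx_id cast_ord_id.
  by rewrite (unsplitK (inl j)) mul_col_mx col_mxEu.
rewrite /pad_kappa /pad_matrix castmx_id cast_ord_id.
by rewrite (unsplitK (inr j)) mul_col_mx col_mxEd mul0mx mxE kappa0_0 mul0r.
Qed.

Lemma is_digital_product m1 m2 s1 s2 (P1 : 'I_(q ^ m1) -> s1.-tuple R)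
    (P2 : 'I_(q ^ m2) -> s2.-tuple R) :
  is_digital P1 -> is_digital P2 -> is_digital (product_points P1 P2).
Proof.
move=> [C1 [eta1 [kappa1 [eta1_bij kappa1_bij P1E]]]].
move=> [C2 [eta2 [kappa2 [eta2_bij kappa2_bij P2E]]]].
(* The zero columns make [C1] read only the low digits and [C2] only the high ones. *)
exists (fun i => match fintype.split i with
  | inl i1 => pad_matrix (erefl (m1 + m2)%N) (row_mx (C1 i1) 0)
  | inr i2 => pad_matrix (addnC m2 m1) (row_mx 0 (C2 i2)) end).
exists (fun r => match fintype.split r with inl r1 => eta1 r1 | inr r2 => eta2 r2 end).
exists (fun i => match fintype.split i with
  | inl i1 => pad_kappa (erefl (m1 + m2)%N) (kappa1 i1)
  | inr i2 => pad_kappa (addnC m2 m1) (kappa2 i2) end).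
split=> [r|i j|n]; first by case: fintype.split.
  by case: fintype.split => i'; exact: pad_kappa_bij.
apply: eq_from_tnth => i; rewrite tnth_mktuple; set v := \col_r _.
(* The digit vector of [n] stacks those of its two parts, so block multiplication isolates the
   relevant one. *)
have vE : v = col_mx (\col_r eta1 r (digit F (low_digits n) r))
                     (\col_r eta2 r (digit F (high_digits n) r)).
  apply/colP => r; rewrite !mxE; case: splitP => r' rE; rewrite mxE.
    by rewrite low_digits_digit rE.
  by rewrite high_digits_digit rE.
case: (split_ordP i) => j ->.
  by rewrite sum_pad vE mul_row_col mul0mx addr0 tnth_lshift
             P1E tnth_mktuple.
by rewrite sum_pad vE mul_row_col mul0mx add0r tnth_rshift
           P2E tnth_mktuple.
Qed.

End ProductDigital.

Theorem theorem1 (R : realType) (F : finFieldType) (m1 m2 s1 s2 u1 u2 : nat)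
    (hm1 : (1 <= m1)%N) (hm2 : (1 <= m2)%N)
    (hs1 : (1 <= s1)%N) (hs2 : (1 <= s2)%N)
    (e : s1.-tuple nat) (f : s2.-tuple nat)
    (he : forall i, (0 < tnth e i)%N) (hf : forall i, (0 < tnth f i)%N)
    (P1 : 'I_(#|F| ^ m1) -> s1.-tuple R) (P2 : 'I_(#|F| ^ m2) -> s2.-tuple R) :
  is_digital_net u1 e P1 ->
  is_digital_net u2 f P2 ->
  exists P : 'I_(#|F| ^ (m1 + m2)) -> (s1 + s2).-tuple R,
    is_digital_net (maxn (m1 + u2) (m2 + u1)) (cat_tuple e f) P.
Proof.
move=> [dig1 net1] [dig2 net2]; exists (product_points P1 P2); split.
  exact: is_digital_product.
by apply: is_net_product => //; exact: card_finField_gt0.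
Qed.
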